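(* Let $T$ be a sound LPAD with the bounded term-size property, and let $A$ be a ground atom in the Herbrand base $\mathcal{H}_T$. Then $A$ has a finite set of finite explanations that is covering with respect to $A$.
   Context: Programs are over a first-order language with finitely many function and constant symbols (possibly including non-constant function symbols). Normal programs and well-founded semantics: a normal program is a set of clauses $B\leftarrow L_1,\ldots,L_n$ ($B$ an atom, $L_i$ literals). For a 3-valued interpretation $I=\langle Tr;Fa\rangle$ (atom $A$ true in $I$ iff $A\in Tr$, false iff $A\in Fa$; $\neg A$ true iff $A$ false and false iff $A$ true), define $True^P_I(Tr)=\{A\mid A$ not true in $I$ and there is a clause $B\leftarrow L_1,\ldots,L_n$ of $P$ and ground substitution $\theta$ with $A=B\theta$ and each $L_i\theta$ true in $I$ or in $Tr\}$ and $False^P_I(Fa)=\{A\mid A$ not false in $I$ and for every clause $B\leftarrow L_1,\ldots,L_n$ and ground $\theta$ with $A=B\theta$ some $L_i\theta$ is false in $I$ or in $Fa\}$. Let $\mathcal{T}_I$ be the least fixed point of $True^P_I$ and $\mathcal{F}_I$ the greatest fixed point of $False^P_I$. Set $WFM_0=\langle\emptyset;\emptyset\rangle$, $WFM_{\alpha+1}=WFM_\alpha\cup\langle\mathcal{T}_{WFM_\alpha};\mathcal{F}_{WFM_\alpha}\rangle$, unions at limits; $WFM(P)$, the well-founded model, is $WFM_\delta$ for the least $\delta$ with $\mathcal{T}_{WFM_\delta}=\mathcal{F}_{WFM_\delta}=\emptyset$. An application of $True^P_I(Tr)$ has the bounded term-size property if there is an integer $L$ bounding the size of every ground substitution $\theta$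 used to produce an atom of $True^P_I(Tr)$; $P$ has the bounded term-size property if every application of $True^P_I$ used to construct $WFM(P)$ has this property with the same bound $L$. LPADs: a Logic Program with Annotated Disjunctions is a finite set of clauses $C = H_1:\alpha_1\vee\cdots\vee H_n:\alpha_n\leftarrow L_1,\ldots,L_m$ with atoms $H_j$, literals $L_i$, and $\alpha_j\in[0,1]$ with $\sum_j\alpha_j\le 1$; if $\sum_j\alpha_j<1$ the head implicitly contains an extra atom $null$ (appearing in no body) with annotation $1-\sum_j\alpha_j$. $head(C)$ is the resulting set of annotated atoms, $H_i(C)$ the $i$-th head atom, $body(C)$ the body. An atomic choice is a triple $(C,\theta,i)$ with $C\in T$, $\theta$ a minimal substitution grounding $C$, and $i\in\{1,\ldots,|head(C)|\}$. A composite choice is a set of atomic choices that is consistent (never contains $(C,\theta,i)$ and $(C,\theta,j)$ with $i\ne j$). A selection $\sigma$ is a composite choice containing an atomic choice $(C,\theta,i)$ for every ground instance $C\theta$ of every clause of $T$; it determines the world $w_\sigma=\{H_i(C)\theta\leftarrow body(C)\theta \mid (C,\theta,i)\in\sigma\}$, a normal program. For a composite choice $\kappa$, $\omega_\kappa$ is the set of worlds $w_\sigma$ with $\sigma\supseteq\kappa$, and for a set $K$ of composite choices $\omega_K=\bigcup_{\kappa\in K}\omega_\kappa$. $T$ is sound if every world has a two-valued (total) well-founded model. $T$ has the bounded term-size property if each of its worlds has the bounded term-size property. A composite choice $\kappa$ is an explanation for a ground atom $A$ if $A$ is true in the well-founded model of every world in $\omega_\kappa$; it is finite if it is a finite set.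 A set $K$ of composite choices is covering with respect to $A$ if every world in whose well-founded model $A$ is true belongs to $\omega_K$. *)

(* Defs.v *)
From Stdlib Require Import Reals List.
Import ListNotations.

Record language := {
  Fsym : Type;
  Psym : Type;
  farity : Fsym -> nat;
  parity : Psym -> nat }.

Inductive term (F : Type) : Type :=
| Var (x : nat)
| Fn (f : F) (args : list (term F)).
Arguments Var {F} x.
Arguments Fn {F} f args.

Record atom (L : language) := mkAtom { apred : Psym L; aargs : list (term (Fsym L)) }.
Arguments mkAtom {L}. Arguments apred {L}. Arguments aargs {L}.

Inductive literal (L : language) :=
| Pos (a : atom L)
| Neg (a : atom L).
Arguments Pos {L}. Arguments Neg {L}.

Definition lit_atom {L} (l : literal L) : atom L :=
  match l with Pos a => a | Neg a => a end.

Fixpoint wf_term (L : language) (t : term (Fsym L)) : Prop :=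
  match t with
  | Var _ => True
  | Fn f ts => length ts = farity L f /\
      (fix go (us : list (term (Fsym L))) : Prop :=
         match us with [] => True | u :: us' => wf_term L u /\ go us' end) ts
  end.

Fixpoint ground_term {F} (t : term F) : Prop :=
  match t with
  | Var _ => False
  | Fn _ ts =>
      (fix go (us : list (term F)) : Prop :=
         match us with [] => True | u :: us' => ground_term u /\ go us' end) ts
  end.

Fixpoint tsize {F} (t : term F) : nat :=
  match t with
  | Var _ => 1
  | Fn _ ts => S ((fix go (us : list (term F)) : nat :=
                     match us with [] => 0 | u :: us' => tsize u + go us' end) ts)
  end.

Fixpoint tvars {F} (t : term F) : list nat :=
  match t with
  | Var x => [x]
  | Fn _ ts => (fix go (us : list (term F)) : list nat :=
                  match us with [] => [] | u :: us' => tvars u ++ go us' end) ts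
  end.

Definition wf_atom {L} (a : atom L) : Prop :=
  length (aargs a) = parity L (apred a) /\ Forall (wf_term L) (aargs a).
Definition ground_atom {L} (a : atom L) : Prop := Forall ground_term (aargs a).
Definition herbrand_base {L} (a : atom L) : Prop := wf_atom a /\ ground_atom a.

Definition avars {L} (a : atom L) : list nat := flat_map tvars (aargs a).

Definition subst (L : language) := nat -> option (term (Fsym L)).

Fixpoint tsubst {L} (th : subst L) (t : term (Fsym L)) : term (Fsym L) :=
  match t with
  | Var x => match th x with Some u => u | None => Var x end
  | Fn f ts => Fn f (map (tsubst th) ts)
  end.
Definition asubst {L} (th : subst L) (a : atom L) : atom L :=
  mkAtom (apred a) (map (tsubst th) (aargs a)).
Definition lsubst {L} (th : subst L) (l : literal L) : literal L :=
  match l with Pos a => Pos (asubst th a) | Neg a => Neg (asubst th a) end.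

(** H_1:a_1 \/ ... \/ H_n:a_n <- L_1,...,L_m *)
Record lclause (L : language) := mkLClause {
  lheads : list (atom L * R);
  lbody : list (literal L) }.
Arguments lheads {L}. Arguments lbody {L}.

Definition lpad (L : language) := list (lclause L).

Definition sum_ann {L} (C : lclause L) : R := fold_right Rplus 0%R (map snd (lheads C)).

(** head(C): the annotated head atoms, with the implicit extra atom null
    (represented by None) when the annotations sum to less than 1.
    Only the atoms matter below; position i (0-based) is the (i+1)-th head atom. *)
Definition head_ext {L} (C : lclause L) : list (option (atom L)) :=
  map (fun h => Some (fst h)) (lheads C) ++
  (if Rlt_dec (sum_ann C) 1 then [None] else []).

Definition clause_var {L} (C : lclause L) (x : nat) : Prop :=
  In x (flat_map (fun h => avars (fst h)) (lheads C) ++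
        flat_map (fun l => avars (lit_atom l)) (lbody C)).

Definition valid_lpad {L} (T : lpad L) : Prop :=
  forall C, In C T ->
    (forall h, In h (lheads C) -> (0 <= snd h <= 1)%R /\ wf_atom (fst h)) /\
    (sum_ann C <= 1)%R /\
    (forall l, In l (lbody C) -> wf_atom (lit_atom l)).

Definition grounding {L} (C : lclause L) (th : subst L) : Prop :=
  forall x, (clause_var C x -> exists t, th x = Some t /\ ground_term t /\ wf_term L t) /\
            (~ clause_var C x -> th x = None).

(** atomic choices (C, theta, i); i is 0-based here *)
Definition achoice (L : language) := (lclause L * subst L * nat)%type.

Definition is_achoice {L} (T : lpad L) (a : achoice L) : Prop :=
  let '(C, th, i) := a in In C T /\ grounding C th /\ (i < length (head_ext C))%nat.

Definition cchoice (L : language) := achoice L -> Prop.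

Definition subchoice {L} (k1 k2 : cchoice L) : Prop := forall a, k1 a -> k2 a.

Definition is_cchoice {L} (T : lpad L) (k : cchoice L) : Prop :=
  (forall a, k a -> is_achoice T a) /\
  (forall C th i j, k (C, th, i) -> k (C, th, j) -> i = j).

Definition finite_choice {L} (k : cchoice L) : Prop :=
  exists l : list (achoice L), forall a, k a <-> In a l.

Definition selection {L} (T : lpad L) (s : cchoice L) : Prop :=
  is_cchoice T s /\
  (forall C th, In C T -> grounding C th -> exists i, s (C, th, i)).

(** A ground clause instance B theta <- L_1 theta, ..., L_n theta, recorded
    together with the ground substitution theta that produced it.  Heads are
    [option atom], None standing for the atom null. *)
Record ginst (L : language) := mkGinst {
  ghead : option (atom L);
  gbody : list (literal L);
  gsub : subst L }.
Arguments mkGinst {L}. Arguments ghead {L}. Arguments gbody {L}. Arguments gsub {L}.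

Definition gprog (L : language) := ginst L -> Prop.

Definition world {L} (s : cchoice L) : gprog L :=
  fun r => exists C th i h,
    s (C, th, i) /\ nth_error (head_ext C) i = Some h /\
    ghead r = option_map (asubst th) h /\
    gbody r = map (lsubst th) (lbody C) /\
    gsub r = th.

Record interp (L : language) := mkInterp {
  itrue : option (atom L) -> Prop;
  ifalse : option (atom L) -> Prop }.
Arguments mkInterp {L}. Arguments itrue {L}. Arguments ifalse {L}.

Definition aset (L : language) := option (atom L) -> Prop.

Definition lit_true {L} (I : interp L) (l : literal L) : Prop :=
  match l with Pos a => itrue I (Some a) | Neg a => ifalse I (Some a) end.
Definition lit_false {L} (I : interp L) (l : literal L) : Prop :=
  match l with Pos a => ifalse I (Some a) | Neg a => itrue I (Some a) end.

(** literal true in the set Tr (i.e. in <Tr; {}>) / false in Fa (in <{}; Fa>) *)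
Definition lit_true_in {L} (Tr : aset L) (l : literal L) : Prop :=
  match l with Pos a => Tr (Some a) | Neg _ => False end.
Definition lit_false_in {L} (Fa : aset L) (l : literal L) : Prop :=
  match l with Pos a => Fa (Some a) | Neg _ => False end.

Definition hb_opt {L} (A : option (atom L)) : Prop :=
  match A with None => True | Some a => herbrand_base a end.

Definition body_true {L} (I : interp L) (Tr : aset L) (r : ginst L) : Prop :=
  forall l, In l (gbody r) -> lit_true I l \/ lit_true_in Tr l.

Definition True_op {L} (P : gprog L) (I : interp L) (Tr : aset L) : aset L :=
  fun A => ~ itrue I A /\ exists r, P r /\ ghead r = A /\ body_true I Tr r.

Definition False_op {L} (P : gprog L) (I : interp L) (Fa : aset L) : aset L :=
  fun A => hb_opt A /\ ~ ifalse I A /\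
    forall r, P r -> ghead r = A ->
      exists l, In l (gbody r) /\ (lit_false I l \/ lit_false_in Fa l).

Definition lfp {L} (Op : aset L -> aset L) : aset L :=
  fun A => forall X : aset L, (forall B, Op X B -> X B) -> X A.
Definition gfp {L} (Op : aset L -> aset L) : aset L :=
  fun A => exists X : aset L, (forall B, X B -> Op X B) /\ X A.

Definition Tfix {L} (P : gprog L) (I : interp L) : aset L := lfp (True_op P I).
Definition Ffix {L} (P : gprog L) (I : interp L) : aset L := gfp (False_op P I).

Definition wfm_succ {L} (P : gprog L) (I : interp L) : interp L :=
  mkInterp (fun A => itrue I A \/ Tfix P I A) (fun A => ifalse I A \/ Ffix P I A).

Definition isup {L} (S : interp L -> Prop) : interp L :=
  mkInterp (fun A => exists I, S I /\ itrue I A) (fun A => exists I, S I /\ ifalse I A).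

(** The stages WFM_alpha (alpha an ordinal): generated from the successor
    step and unions (the empty union is WFM_0). *)
Inductive wfm_stage {L} (P : gprog L) : interp L -> Prop :=
| ws_succ I : wfm_stage P I -> wfm_stage P (wfm_succ P I)
| ws_sup (S : interp L -> Prop) :
    (forall I, S I -> wfm_stage P I) -> wfm_stage P (isup S).

Definition is_wfm {L} (P : gprog L) (M : interp L) : Prop :=
  wfm_stage P M /\ (forall A, ~ Tfix P M A) /\ (forall A, ~ Ffix P M A).

Definition wfm_true {L} (P : gprog L) (a : atom L) : Prop :=
  exists M, is_wfm P M /\ itrue M (Some a).

Definition two_valued {L} (M : interp L) : Prop :=
  forall a, herbrand_base a -> itrue M (Some a) \/ ifalse M (Some a).

(** Iterates of True_I from the empty set (towards its least fixed point). *)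
Inductive true_iter {L} (P : gprog L) (I : interp L) : aset L -> Prop :=
| ti_app Tr : true_iter P I Tr -> true_iter P I (True_op P I Tr)
| ti_sup (S : aset L -> Prop) :
    (forall X, S X -> true_iter P I X) ->
    true_iter P I (fun A => exists X, S X /\ X A).

(** every ground substitution used to produce an atom of True_I(Tr) has size
    at most Lb (size of a substitution = max size of the terms in its range) *)
Definition app_bounded {L} (P : gprog L) (I : interp L) (Tr : aset L) (Lb : nat) : Prop :=
  forall r, P r -> ~ itrue I (ghead r) -> body_true I Tr r ->
    forall x t, gsub r x = Some t -> (tsize t <= Lb)%nat.

Definition bounded_term_size {L} (P : gprog L) : Prop :=
  exists Lb, forall I Tr, wfm_stage P I -> true_iter P I Tr -> app_bounded P I Tr Lb.

Definition sound {L} (T : lpad L) : Prop :=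
  forall s, selection T s -> forall M, is_wfm (world s) M -> two_valued M.

Definition lpad_bounded_term_size {L} (T : lpad L) : Prop :=
  forall s, selection T s -> bounded_term_size (world s).

Definition explanation {L} (T : lpad L) (a : atom L) (k : cchoice L) : Prop :=
  is_cchoice T k /\
  forall s, selection T s -> subchoice k s -> wfm_true (world s) a.

Definition covering_wrt {L} (T : lpad L) (a : atom L) (K : cchoice L -> Prop) : Prop :=
  forall s, selection T s -> wfm_true (world s) a ->
    exists k, K k /\ subchoice k s.

(* Main.v *)
(** Write M_g for the well-founded model of the world of a selection g.  Each M_g
    is total with finitely many true atoms, so it is the unique stable model of
    its world.  Call a ground instance sensitive for g if its body is true in M_g
    and one of its possible heads is not.  If only finitely many instances are
    sensitive, their choices, together with those of the finitely many small
    instances used to derive M_g, force M_g: it stays a stable model of every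
    world agreeing with g there.  So truth of A depends on g continuously, and a
    Koenig argument over partial selections yields the finite covering set.

    Suppose infinitely many instances are sensitive.  By pigeonhole there is an
    infinite family D of them from one clause, all with chosen head h and
    alternative head h' not in M_g, and such that in every world either
    finitely many or cofinitely many members of D have a true body.  Switching
    some members of D to h' keeps the body of one of them true, hence makes both
    h and h' true when infinitely many members keep h.  Let J_k be the stages of
    the world of g in which h and h' are protected from becoming false.  They
    stop growing at a finite index, and there every body in D is true.  At the
    first k at which infinitely many members of D become applicable, switch
    infinitely many of those to h': the J_i with i <= k are then stages of the new
    world, h' is not yet true, and infinitely many substitutions produce it in
    one application, contradicting bounded term-size. *)

Require Import Defs.
From Stdlib Require Import Reals List.
From Stdlib Require Import Lia Arith Classical ClassicalEpsilon
  FunctionalExtensionality PropExtensionality.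
Import ListNotations.

(** * Finite and infinite predicates *)

(** The list may contain extra elements, so subsets inherit coverings; [~ covered D] expresses that
    [D] is infinite. *)
Definition covered {X} (D : X -> Prop) : Prop := exists l, forall x, D x -> In x l.

Lemma covered_sub {X} (D D' : X -> Prop) :
  (forall x, D x -> D' x) -> covered D' -> covered D.
Proof. intros H [l Hl]; exists l; auto. Qed.

Lemma covered_union {X Y} (ys : list Y) (R : Y -> X -> Prop) :
  (forall y, In y ys -> covered (R y)) -> covered (fun x => exists y, In y ys /\ R y x).
Proof.
  induction ys as [|y ys IH]; intros H.
  - exists []; intros x (y & [] & _).
  - destruct IH as [l Hl]; [intros z Hz; apply H; now right|].
    destruct (H y (or_introl eq_refl)) as [l' Hl'].
    exists (l' ++ l); intros x (z & [->|Hz] & Hx); apply in_or_app; [left|right]; eauto.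
Qed.

Lemma covered_image {X Y} (D : X -> Prop) (f : X -> Y) :
  covered D -> covered (fun y => exists x, D x /\ y = f x).
Proof.
  intros [l Hl]; exists (map f l); intros y (x & Hx & ->); apply in_map; auto.
Qed.

Lemma covered_or {X} (D D' : X -> Prop) :
  covered D -> covered D' -> covered (fun x => D x \/ D' x).
Proof.
  intros [l Hl] [l' Hl']; exists (l ++ l'); intros x [H|H]; apply in_or_app; auto.
Qed.

Lemma pigeonhole {X Y} (D : X -> Prop) (ys : list Y) (R : Y -> X -> Prop) :
  ~ covered D -> (forall x, D x -> exists y, In y ys /\ R y x) ->
  exists y, In y ys /\ ~ covered (fun x => D x /\ R y x).
Proof.
  intros HD HR; apply NNPP; intros Hn; apply HD.
  apply covered_sub with (fun x => exists y, In y ys /\ (D x /\ R y x)).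
  - intros x Hx; destruct (HR x Hx) as (y & Hy & Hr); eauto.
  - apply covered_union; intros y Hy; apply NNPP; intros Hc; apply Hn; eauto.
Qed.

Lemma infinite_minus {X} (D F : X -> Prop) :
  ~ covered D -> covered F -> ~ covered (fun x => D x /\ ~ F x).
Proof.
  intros HD HF HC; apply HD.
  eapply covered_sub; [|exact (covered_or _ _ HF HC)].
  intros x Hx; destruct (classic (F x)); auto.
Qed.

Lemma infinite_inhabited {X} (D : X -> Prop) : ~ covered D -> exists x, D x.
Proof.
  intros HD; apply NNPP; intros Hn; apply HD; exists []; intros x Hx; apply Hn; eauto.
Qed.

Lemma infinite_sequence {X} (D : X -> Prop) :
  ~ covered D -> exists f : nat -> X, (forall n, D (f n)) /\ forall m n, m < n -> f m <> f n.
Proof.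
  intros HD.
  assert (Hc : forall l, exists x, D x /\ ~ In x l).
  { intros l; apply NNPP; intros Hn; apply HD; exists l; intros x Hx.
    apply NNPP; intros Hx'; apply Hn; eauto. }
  apply choice in Hc; destruct Hc as [F HF].
  (* [l n] collects the terms chosen before step [n], and [F] picks a member of [D] outside a given
     list. *)
  set (l := fix l n := match n with 0 => [] | S n => F (l n) :: l n end).
  exists (fun n => F (l n)); split; [intros n; apply HF|].
  intros m n Hmn E; apply (proj2 (HF (l n))); rewrite <- E.
  clear E; induction Hmn; simpl; auto.
Qed.

Lemma infinite_split {X} (D : X -> Prop) :
  ~ covered D ->
  exists D', (forall x, D' x -> D x) /\ ~ covered D' /\ ~ covered (fun x => D x /\ ~ D' x).
Proof.
  intros HD; destruct (infinite_sequence D HD) as (f & Hf & Hinj).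
  assert (Hne : forall m n, m <> n -> f m <> f n).
  { intros m n Hmn E; destruct (Nat.lt_total m n) as [H|[H|H]]; [|lia|];
      apply (Hinj _ _ H); congruence. }
  assert (Hinf : forall h : nat -> nat, (forall m n, h m = h n -> m = n) ->
            ~ covered (fun x => exists n, x = f (h n))).
  { intros h Hh [l Hl].
    assert (Hnd : forall k, NoDup (map (fun n => f (h n)) (seq 0 k))).
    { intros k; apply NoDup_map_NoDup_ForallPairs; [|apply seq_NoDup].
      intros a b _ _ E; apply Hh; apply NNPP; intros Hab; exact (Hne _ _ Hab E). }
    assert (Hlen : length (map (fun n => f (h n)) (seq 0 (S (length l)))) <= length l).
    { apply NoDup_incl_length; [apply Hnd|].
      intros x Hx; apply in_map_iff in Hx; destruct Hx as (n & <- & _); eauto. }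
    rewrite length_map, length_seq in Hlen; lia. }
  exists (fun x => exists n, x = f (2 * n)); split; [|split].
  - intros x [n ->]; auto.
  - apply Hinf; intros; lia.
  - intros HC; apply (Hinf (fun n => 2 * n + 1)); [intros; lia|].
    eapply covered_sub; [|exact HC].
    intros x [n ->]; split; [auto|]; intros [m E]; revert E; apply Hne; lia.
Qed.

(** Go through [ls] one element at a time: if some fibre of [f _ l] is infinite, shrink to it;
    otherwise all fibres are finite already. Both outcomes survive further shrinking. *)
Lemma constant_or_finite_to_one {X Y Z} (ls : list Y) (f : X -> Y -> Z) (D : X -> Prop) :
  ~ covered D ->
  exists D', (forall x, D' x -> D x) /\ ~ covered D' /\
    forall l, In l ls ->
      (exists z, forall x, D' x -> f x l = z) \/ (forall z, covered (fun x => D' x /\ f x l = z)).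
Proof.
  induction ls as [|l ls IH]; intros HD.
  - exists D; repeat split; auto; intros l [].
  - destruct (IH HD) as (D1 & Hs & Hi & H1).
    destruct (classic (exists z, ~ covered (fun x => D1 x /\ f x l = z))) as [[z Hz]|Hn].
    + exists (fun x => D1 x /\ f x l = z); split; [intros x [Hx _]; auto|split; [exact Hz|]].
      intros l' [<-|Hl']; [left; exists z; tauto|].
      destruct (H1 l' Hl') as [[z' H']|H']; [left; exists z'; intros x [Hx _]; auto|].
      right; intros z'; eapply covered_sub; [|exact (H' z')]; simpl; tauto.
    + exists D1; split; [auto|split; [auto|]]; intros l' [<-|Hl']; [|auto].
      right; intros z; apply NNPP; eauto.
Qed.

Lemma monotone_stabilises {X} (S : nat -> X -> Prop) (l : list X) :
  (forall m n x, m <= n -> S m x -> S n x) ->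
  exists N, forall n x, In x l -> S n x -> S N x.
Proof.
  intros Hm; induction l as [|y l [N IH]]; [exists 0; intros n x []|].
  destruct (classic (exists n, S n y)) as [[n Hn]|Hn].
  - exists (max N n); intros k x [<-|Hx] Hk.
    + apply (Hm n); [lia|auto].
    + apply (Hm N); [lia|eauto].
  - exists N; intros k x [<-|Hx] Hk; [exfalso|]; eauto.
Qed.

Lemma least_nat (P : nat -> Prop) n : P n -> exists k, P k /\ forall j, j < k -> ~ P j.
Proof.
  induction n as [n IH] using lt_wf_ind; intros Hn.
  destruct (classic (exists j, j < n /\ P j)) as [(j & Hj & HP)|Hno]; [eauto|].
  exists n; split; [auto|]; intros j Hj HP; apply Hno; eauto.
Qed.

(** * Ground terms and substitutions *)

Lemma term_nested_ind {F} (P : term F -> Prop) :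
  (forall x, P (Var x)) -> (forall f ts, Forall P ts -> P (Fn f ts)) -> forall t, P t.
Proof.
  intros HV HF; fix IH 1; intros [x|f ts]; [apply HV|apply HF].
  induction ts as [|u us IHus]; constructor; auto.
Qed.

Lemma wf_Fn (L : language) f (ts : list (term (Fsym L))) :
  wf_term L (Fn f ts) <-> length ts = farity L f /\ Forall (wf_term L) ts.
Proof.
  simpl; apply and_iff_compat_l.
  induction ts as [|u us IH]; [split; auto|].
  rewrite Forall_cons_iff; tauto.
Qed.

Lemma ground_Fn {F} f (ts : list (term F)) : ground_term (Fn f ts) <-> Forall ground_term ts.
Proof.
  simpl; induction ts as [|u us IH]; [split; auto|].
  rewrite Forall_cons_iff; tauto.
Qed.

Lemma tvars_Fn {F} f (ts : list (term F)) : tvars (Fn f ts) = flat_map tvars ts.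
Proof. simpl; induction ts as [|u us IH]; simpl; congruence. Qed.

Lemma tsize_arg {F} f (ts : list (term F)) t : In t ts -> tsize t < tsize (Fn f ts).
Proof.
  simpl; induction ts as [|u us IH]; intros []; [subst; lia|].
  specialize (IH H); lia.
Qed.

Lemma tsubst_ground {L} (th : subst L) t :
  (forall x, In x (tvars t) -> exists u, th x = Some u /\ ground_term u /\ wf_term L u) ->
  ground_term (tsubst th t).
Proof.
  induction t as [x|f ts IH] using term_nested_ind; intros H.
  - destruct (H x (or_introl eq_refl)) as (u & E & Hu & _); simpl; now rewrite E.
  - rewrite tvars_Fn in H; simpl tsubst; apply ground_Fn, Forall_map.
    rewrite Forall_forall in *; intros t Ht; apply IH; [auto|].
    intros x Hx; apply H, in_flat_map; eauto.
Qed.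

Lemma tsubst_wf {L} (th : subst L) t :
  wf_term L t ->
  (forall x, In x (tvars t) -> exists u, th x = Some u /\ ground_term u /\ wf_term L u) ->
  wf_term L (tsubst th t).
Proof.
  induction t as [x|f ts IH] using term_nested_ind; intros Hwf H.
  - destruct (H x (or_introl eq_refl)) as (u & E & _ & Hu); simpl; now rewrite E.
  - rewrite tvars_Fn in H; simpl tsubst; apply wf_Fn in Hwf; apply wf_Fn.
    rewrite length_map, Forall_map; destruct Hwf as [Hl Hwf]; split; [auto|].
    rewrite Forall_forall in *; intros t Ht; apply IH; [auto|auto|].
    intros x Hx; apply H, in_flat_map; eauto.
Qed.

Lemma asubst_herbrand {L} (th : subst L) a :
  wf_atom a ->
  (forall x, In x (avars a) -> exists u, th x = Some u /\ ground_term u /\ wf_term L u) ->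
  herbrand_base (asubst th a).
Proof.
  intros [Hl Hwf] H; unfold herbrand_base, wf_atom, ground_atom; simpl.
  rewrite length_map, !Forall_map; rewrite !Forall_forall in *.
  assert (Ht : forall t x, In t (aargs a) -> In x (tvars t) -> In x (avars a))
    by (intros t x ? ?; apply in_flat_map; eauto).
  repeat split; auto; intros t It; [apply tsubst_wf|apply tsubst_ground]; eauto.
Qed.

Lemma covered_lists {X} (l : list X) k :
  covered (fun xs => length xs = k /\ Forall (fun x => In x l) xs).
Proof.
  induction k as [|k IH].
  - exists [[]]; intros [|x xs] [H _]; [now left|discriminate].
  - eapply covered_sub;
      [|apply (covered_union l (fun x ys => exists xs,
           (length xs = k /\ Forall (fun x => In x l) xs) /\ ys = x :: xs));
         intros x _; apply covered_image; exact IH].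
    intros [|x xs] [H HF]; [discriminate|]; inversion HF; subst.
    exists x; split; [auto|]; exists xs; simpl in H; auto.
Qed.

Lemma covered_ground_terms (L : language) (fs : list (Fsym L)) :
  (forall f, In f fs) ->
  forall n, covered (fun t => ground_term t /\ wf_term L t /\ tsize t <= n).
Proof.
  intros Hfs; induction n as [|n [l Hl]].
  - exists []; intros [x|f ts] (_ & _ & H); simpl in H; lia.
  - eapply covered_sub;
      [|apply (covered_union fs (fun f t => exists ts,
           (length ts = farity L f /\ Forall (fun x => In x l) ts) /\ t = Fn f ts));
         intros f _; apply covered_image, covered_lists].
    intros [x|f ts] (Hg & Hwf & Hs); [destruct Hg|].
    exists f; split; [auto|]; exists ts; apply wf_Fn in Hwf; apply ground_Fn in Hg.
    destruct Hwf as [Hlen Hwf]; repeat split; auto.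
    rewrite Forall_forall in *; intros t Ht; apply Hl; repeat split; auto.
    pose proof (tsize_arg f ts t Ht); lia.
Qed.

Lemma covered_substs {L} (vs : list nat) (ts : list (term (Fsym L))) :
  covered (fun th : subst L =>
    forall x, th x = None \/ (In x vs /\ exists t, In t ts /\ th x = Some t)).
Proof.
  induction vs as [|v vs IH].
  - exists [fun _ => None]; intros th H; left.
    apply functional_extensionality; intros x; destruct (H x) as [E|[[] _]]; auto.
  (* Peel off [v]: a substitution is recovered from its value at [v] and the substitution with [v]
     erased. *)
  - set (upd := fun (o : option (term (Fsym L))) (th : subst L) (x : nat) =>
                  if Nat.eq_dec x v then o else th x).
    eapply covered_sub;
      [|apply (covered_union (None :: map Some ts) (fun o th' => exists th,
           (forall x, th x = None \/ (In x vs /\ exists t, In t ts /\ th x = Some t)) /\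
           th' = upd o th)); intros o _; apply covered_image; exact IH].
    intros th H; exists (th v); split.
    + destruct (H v) as [->|(_ & t & Ht & ->)]; [now left|right; now apply in_map].
    + exists (fun x => if Nat.eq_dec x v then None else th x); split.
      * intros x; destruct (Nat.eq_dec x v) as [|Hne]; [now left|].
        destruct (H x) as [E|([E|Hx] & Ht)]; [now left|congruence|now right].
      * apply functional_extensionality; intros x; unfold upd.
        destruct (Nat.eq_dec x v); congruence.
Qed.

(** * Stages of the well-founded model *)

Definition ile {L} (I J : interp L) : Prop :=
  (forall A, itrue I A -> itrue J A) /\ (forall A, ifalse I A -> ifalse J A).

Lemma lit_true_mono {L} (I J : interp L) l : ile I J -> lit_true I l -> lit_true J l.
Proof. intros [H H']; destruct l; simpl; auto. Qed.

Lemma lit_false_mono {L} (I J : interp L) l : ile I J -> lit_false I l -> lit_false J l.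
Proof. intros [H H']; destruct l; simpl; auto. Qed.

Lemma body_true_mono {L} (I : interp L) (X Y : aset L) r :
  (forall A, X A -> Y A) -> body_true I X r -> body_true I Y r.
Proof.
  intros H Hb l Hl; destruct (Hb l Hl) as [Ht|Ht]; [now left|right].
  destruct l; simpl in *; auto.
Qed.

Lemma Tfix_rule {L} (P : gprog L) I r :
  P r -> ~ itrue I (ghead r) -> body_true I (Tfix P I) r -> Tfix P I (ghead r).
Proof.
  intros Hr Hn Hb X HX; apply HX; split; [auto|]; exists r; repeat split; auto.
  eapply body_true_mono; [|exact Hb]; intros A HA; apply HA; auto.
Qed.

Lemma Tfix_least {L} (P : gprog L) I (X : aset L) :
  (forall r, P r -> ~ itrue I (ghead r) -> body_true I X r -> X (ghead r)) ->
  forall A, Tfix P I A -> X A.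
Proof. intros H A HA; apply HA; intros B [Hn (r & Hr & <- & Hb)]; auto. Qed.

Lemma Tfix_disjoint {L} (P : gprog L) I A : Tfix P I A -> ~ itrue I A.
Proof.
  intros HA; pattern A; revert A HA; apply Tfix_least; auto.
Qed.

Lemma Tfix_strong_ind {L} (P : gprog L) I (X : aset L) :
  (forall r, P r -> ~ itrue I (ghead r) ->
     body_true I (fun A => Tfix P I A /\ X A) r -> X (ghead r)) ->
  forall A, Tfix P I A -> X A.
Proof.
  intros H; enough (HE : forall A, Tfix P I A -> Tfix P I A /\ X A).
  { intros A HA; now apply HE. }
  apply Tfix_least; intros r Hr Hn Hb; split; [|auto].
  apply Tfix_rule; auto; eapply body_true_mono; [|exact Hb]; simpl; tauto.
Qed.

Lemma Ffix_unfold {L} (P : gprog L) I A : Ffix P I A -> False_op P I (Ffix P I) A.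
Proof.
  intros (X & HX & HA); destruct (HX A HA) as (Hh & Hn & Hr); repeat split; auto.
  intros r Pr Er; destruct (Hr r Pr Er) as (l & Hl & Hf); exists l; split; [auto|].
  destruct Hf as [Hf|Hf]; [now left|right]; destruct l; simpl in *; [|auto].
  exists X; auto.
Qed.

Lemma Ffix_greatest {L} (P : gprog L) I (X : aset L) :
  (forall A, X A -> False_op P I X A) -> forall A, X A -> Ffix P I A.
Proof. intros H A HA; exists X; auto. Qed.

(** The atoms unfounded for [P] at [I] but not false in [J] form an unfounded set of [P'] at [J],
    which must be empty. *)
Lemma Ffix_transfer {L} (P P' : gprog L) I J :
  (forall r, P' r -> Ffix P I (ghead r) -> P r) -> ile I J ->
  (forall A, ~ Ffix P' J A) -> forall A, Ffix P I A -> ifalse J A.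
Proof.
  intros HP HIJ HJ A HA; apply NNPP; intros HnA; apply (HJ A).
  apply (Ffix_greatest P' J (fun B => Ffix P I B /\ ~ ifalse J B)); [|auto].
  intros B [HB HnB]; destruct (Ffix_unfold _ _ _ HB) as (Hh & _ & Hr); repeat split; auto.
  intros r Pr <-; destruct (Hr r (HP r Pr HB) eq_refl) as (l & Hl & Hf); exists l; split; [auto|].
  destruct Hf as [Hf|Hf]; [left; eapply lit_false_mono; eauto|].
  destruct l as [a|a]; simpl in *; [|destruct Hf].
  destruct (classic (ifalse J (Some a))); auto.
Qed.

Lemma Tfix_sub {L} (P : gprog L) I J :
  (forall r, P r -> (forall l, In l (gbody r) -> lit_true J l) -> itrue J (ghead r)) ->
  ile I J -> forall A, Tfix P I A -> itrue J A.
Proof.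
  intros HT HIJ; apply Tfix_least; intros r Hr Hn Hb; apply HT; [auto|].
  intros l Hl; destruct (Hb l Hl) as [H|H]; [eapply lit_true_mono; eauto|].
  destruct l; simpl in *; tauto.
Qed.

Lemma stage_le {L} (P : gprog L) J :
  (forall r, P r -> (forall l, In l (gbody r) -> lit_true J l) -> itrue J (ghead r)) ->
  (forall I, wfm_stage P I -> ile I J -> forall A, Ffix P I A -> ifalse J A) ->
  forall I, wfm_stage P I -> ile I J.
Proof.
  intros HT HF I HI; induction HI as [I HI IH|S HS IH].
  - split; simpl; intros A [HA|HA]; try (now apply IH);
      [eapply Tfix_sub; eauto|eapply HF; eauto].
  - split; simpl; intros A (I & SI & HA); eapply (IH I SI); eauto.
Qed.

(** Unions of arbitrary families of stages are stages, so the union of all stages is the largest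
    one. This gives the well-founded model without ordinals. *)
Definition WM {L} (P : gprog L) : interp L := isup (wfm_stage P).

Lemma WM_stage {L} (P : gprog L) : wfm_stage P (WM P).
Proof. apply ws_sup; auto. Qed.

Lemma stage_WM {L} (P : gprog L) I : wfm_stage P I -> ile I (WM P).
Proof. intros HI; split; intros A HA; exists I; auto. Qed.

Lemma WM_is_wfm {L} (P : gprog L) : is_wfm P (WM P).
Proof.
  pose proof (stage_WM P _ (ws_succ _ _ (WM_stage P))) as [HT HF].
  split; [apply WM_stage|split]; intros A HA.
  - apply (Tfix_disjoint _ _ _ HA), HT; simpl; auto.
  - apply (proj1 (proj2 (Ffix_unfold _ _ _ HA))), HF; simpl; auto.
Qed.

Lemma wfm_true_WM {L} (P : gprog L) a : wfm_true P a <-> itrue (WM P) (Some a).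
Proof.
  split.
  - intros (M & (HM & _) & Ha); now apply (stage_WM P M HM).
  - intros Ha; exists (WM P); split; [apply WM_is_wfm|auto].
Qed.

Lemma WM_rule {L} (P : gprog L) r :
  P r -> (forall l, In l (gbody r) -> lit_true (WM P) l) -> itrue (WM P) (ghead r).
Proof.
  intros Hr Hb; apply NNPP; intros Hn.
  apply (proj1 (proj2 (WM_is_wfm P)) (ghead r)), Tfix_rule; auto.
  intros l Hl; left; auto.
Qed.

(** * Compatibility of stages *)

Definition compatible {L} (I J : interp L) : Prop :=
  forall A, ~ (itrue I A /\ ifalse J A) /\ ~ (ifalse I A /\ itrue J A).

Lemma compatible_sym {L} (I J : interp L) : compatible I J -> compatible J I.
Proof. intros H A; specialize (H A); tauto. Qed.

Lemma compatible_lit {L} (I J : interp L) l :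
  compatible I J -> lit_true I l -> lit_false J l -> False.
Proof. intros H; destruct l as [a|a]; simpl; specialize (H (Some a)); tauto. Qed.

(** Induction on the derivation of [A]: unfoundedness makes some body literal of the deriving rule
    false. The literal is true by [I] or by [Tfix], false by [J] or by [Ffix]; three combinations
    contradict a compatibility hypothesis, the fourth the induction hypothesis. *)
Lemma Tfix_Ffix_disjoint {L} (P : gprog L) I J :
  compatible I J -> compatible (wfm_succ P I) J -> compatible I (wfm_succ P J) ->
  forall A, Tfix P I A -> ~ Ffix P J A.
Proof.
  intros H1 H2 H3; apply Tfix_strong_ind; intros r Hr Hn Hb HF.
  destruct (Ffix_unfold _ _ _ HF) as (_ & _ & Hall).
  destruct (Hall r Hr eq_refl) as (l & Hl & Hf).
  destruct (Hb l Hl) as [Ht|Ht], Hf as [Hf|Hf].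
  - exact (compatible_lit _ _ _ H1 Ht Hf).
  - eapply compatible_lit; [exact H3|exact Ht|].
    destruct l; simpl in *; tauto.
  - eapply compatible_lit; [exact H2| |exact Hf].
    destruct l; simpl in *; tauto.
  - destruct l; simpl in *; tauto.
Qed.

(** Stages carry no index and need not be visibly comparable, hence the nested induction. Two
    successors are the essential case, where [Tfix_Ffix_disjoint] is applied both ways round. *)
Lemma stages_compatible {L} (P : gprog L) I J :
  wfm_stage P I -> wfm_stage P J -> compatible I J.
Proof.
  intros HI; revert J; induction HI as [I HI IHI|S HS IHI]; intros J HJ.
  - induction HJ as [J HJ IHJ|S HS IHJ].
    + pose proof (IHI J HJ) as H1; pose proof (IHI _ (ws_succ _ _ HJ)) as H3.
      pose proof (Tfix_Ffix_disjoint P I J H1 IHJ H3) as HA.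
      pose proof (Tfix_Ffix_disjoint P J I (compatible_sym _ _ H1)
                    (compatible_sym _ _ H3) (compatible_sym _ _ IHJ)) as HB.
      intros A; specialize (HA A); specialize (HB A); specialize (H1 A);
        specialize (H3 A); specialize (IHJ A); simpl in *; tauto.
    + intros A; split; [intros [HA (K & SK & HK)]|intros [HA (K & SK & HK)]];
        specialize (IHJ K SK A); tauto.
  - intros A; split; intros [(K & SK & HK) HA];
      specialize (IHI K SK J HJ A); tauto.
Qed.

Lemma WM_consistent {L} (P : gprog L) l : lit_true (WM P) l -> lit_false (WM P) l -> False.
Proof. apply compatible_lit, (stages_compatible P); apply WM_stage. Qed.

(** * Bounded term size at fixed points *)

Definition sized {L} (th : subst L) (n : nat) : Prop := forall x t, th x = Some t -> tsize t <= n.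

Lemma bounded_Tfix {L} (P : gprog L) :
  bounded_term_size P ->
  exists n, forall I r, wfm_stage P I -> P r -> ~ itrue I (ghead r) ->
    body_true I (Tfix P I) r -> sized (gsub r) n.
Proof.
  intros [n Hn]; exists n; intros I r HI Hr Hh Hb.
  (* The union of all iterates contains the least fixed point, since applying [True_op] to it gives
     another iterate. The bound for this one application thus covers every rule that fires at
     [I]. *)
  set (U := fun A => exists X, true_iter P I X /\ X A).
  assert (HU : true_iter P I U) by (apply ti_sup; auto).
  intros x t; apply (Hn I U HI HU r Hr Hh); eapply body_true_mono; [|exact Hb].
  intros A HA; apply HA; intros B HB; exists (True_op P I U); split; [now apply ti_app|auto].
Qed.

Lemma bounded_true {L} (P : gprog L) :
  bounded_term_size P ->
  exists n, forall A, itrue (WM P) A -> exists r, P r /\ ghead r = A /\ sized (gsub r) n.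
Proof.
  intros HP; destruct (bounded_Tfix P HP) as [n Hn]; exists n.
  intros A (I & HI & HA); revert A HA; induction HI as [I HI IH|S HS IH]; simpl.
  - intros A [HA|HA]; [auto|].
    revert A HA; apply Tfix_strong_ind; intros r Hr Hh Hb; exists r; repeat split; auto.
    apply (Hn I); auto; eapply body_true_mono; [|exact Hb]; simpl; tauto.
  - intros A (I & SI & HA); eauto.
Qed.

(** * Worlds of an LPAD *)

Definition inst (L : language) := (lclause L * subst L)%type.

Definition hd {L} (c : inst L) (i : nat) : option (atom L) :=
  match nth_error (head_ext (fst c)) i with
  | Some h => option_map (asubst (snd c)) h
  | None => None
  end.
Definition bd {L} (c : inst L) : list (literal L) := map (lsubst (snd c)) (lbody (fst c)).
Definition rule {L} (c : inst L) (i : nat) : ginst L := mkGinst (hd c i) (bd c) (snd c).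

Definition valid {L} (T : lpad L) (c : inst L) : Prop := In (fst c) T /\ grounding (fst c) (snd c).

(* Selections are handled as functions assigning a head index to every ground
   instance; [ok] says that the indices are in range. *)
Definition ok {L} (T : lpad L) (g : inst L -> nat) : Prop :=
  forall c, valid T c -> g c < length (head_ext (fst c)).
Definition sel {L} (T : lpad L) (g : inst L -> nat) : cchoice L :=
  fun a => valid T (fst a) /\ snd a = g (fst a).
Definition W {L} (T : lpad L) (g : inst L -> nat) : gprog L :=
  fun r => exists c, valid T c /\ r = rule c (g c).

Definition btrue {L} (I : interp L) (c : inst L) : Prop := forall l, In l (bd c) -> lit_true I l.

Lemma btrue_mono {L} (I J : interp L) c : ile I J -> btrue I c -> btrue J c.
Proof. intros H Hb l Hl; eapply lit_true_mono; eauto. Qed.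

Lemma sel_selection {L} (T : lpad L) g : ok T g -> selection T (sel T g).
Proof.
  intros Hg; split; [split|].
  - intros [[C th] i] [[HC Hth] E]; simpl in *; subst.
    assert (Hv : valid T (C, th)) by (split; auto); exact (conj HC (conj Hth (Hg _ Hv))).
  - intros C th i j [_ Hi] [_ Hj]; simpl in *; congruence.
  - intros C th HC Hth; exists (g (C, th)).
    exact (conj (conj HC Hth) eq_refl).
Qed.

Lemma selection_sel {L} (T : lpad L) s : selection T s -> exists g, ok T g /\ s = sel T g.
Proof.
  intros [[Hs Hc] Ht].
  assert (Hex : forall c, exists i, valid T c -> s (c, i)).
  { intros [C th]; destruct (classic (valid T (C, th))) as [[H1 H2]|Hn].
    - destruct (Ht C th H1 H2) as [i Hi]; eauto.
    - exists 0; tauto. }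
  apply choice in Hex; destruct Hex as [g Hg]; exists g; split.
  - intros [C th] Hv; apply (Hs _ (Hg _ Hv)).
  - apply functional_extensionality; intros [[C th] i]; apply propositional_extensionality; split.
    + intros Ha; destruct (Hs _ Ha) as (H1 & H2 & _).
      assert (Hv : valid T (C, th)) by (split; auto).
      split; [auto|]; exact (Hc _ _ _ _ Ha (Hg _ Hv)).
    + intros [Hv E]; simpl in *; subst; auto.
Qed.

Lemma world_sel {L} (T : lpad L) g : ok T g -> world (sel T g) = W T g.
Proof.
  intros Hg; apply functional_extensionality; intros [h b t].
  apply propositional_extensionality; unfold world, W, rule, hd; split.
  - intros (C & th & i & h' & [Hv E] & Hn & Hh & Hb & Ht); simpl in *; subst.
    exists (C, th); split; [auto|]; simpl; now rewrite Hn.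
  - intros ([C th] & Hv & E); simpl in *.
    pose proof (Hg _ Hv) as Hlt; apply nth_error_Some in Hlt; simpl in Hlt.
    destruct (nth_error (head_ext C) (g (C, th))) as [h'|] eqn:En; [|congruence].
    injection E as -> -> ->.
    exists C, th, (g (C, th)), h'; repeat split; auto; apply Hv.
Qed.

Lemma clause_var_body {L} (C : lclause L) l x :
  In l (lbody C) -> In x (avars (lit_atom l)) -> clause_var C x.
Proof. intros Hh Hx; apply in_or_app; right; apply in_flat_map; eauto. Qed.

Lemma bd_herbrand {L} (T : lpad L) c l :
  valid_lpad T -> valid T c -> In l (bd c) -> herbrand_base (lit_atom l).
Proof.
  intros HT [HC Hg] Hl; apply in_map_iff in Hl; destruct Hl as (k & <- & Hk).
  replace (lit_atom (lsubst (snd c) k)) with (asubst (snd c) (lit_atom k))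
    by (destruct k; reflexivity).
  apply asubst_herbrand; [now apply (HT _ HC)|].
  intros x Hx; apply (Hg x); eapply clause_var_body; eauto.
Qed.

(** A grounding binds only the finitely many variables of its clause. Hence every valid instance is
    eventually decided in the compactness argument, which proceeds by size. *)
Lemma grounding_sized {L} (C : lclause L) th : grounding C th -> exists n, sized th n.
Proof.
  intros Hg; unfold grounding, clause_var in Hg.
  set (vs := _ ++ _) in Hg; clearbody vs.
  enough (H : exists n, forall x t, In x vs -> th x = Some t -> tsize t <= n).
  { destruct H as [n Hn]; exists n; intros x t E; apply (Hn x t); [|auto].
    apply NNPP; intros Hx; apply (Hg x) in Hx; congruence. }
  clear Hg; induction vs as [|v vs [n IH]]; [exists 0; intros x t []|].
  exists (max n (match th v with Some t => tsize t | None => 0 end)).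
  intros x t [<-|Hx] E; [rewrite E|specialize (IH x t Hx E)]; lia.
Qed.

Lemma covered_valid_sized {L} (T : lpad L) :
  (exists fs : list (Fsym L), forall f, In f fs) ->
  forall n, covered (fun c : inst L => valid T c /\ sized (snd c) n).
Proof.
  intros [fs Hfs] n; destruct (covered_ground_terms L fs Hfs n) as [ts Hts].
  apply covered_sub with (fun c : inst L => exists C, In C T /\
    exists th, (forall x, th x = None \/
       (In x (flat_map (fun h => avars (fst h)) (lheads C) ++
              flat_map (fun l => avars (lit_atom l)) (lbody C)) /\
        exists t, In t ts /\ th x = Some t)) /\ c = (C, th)).
  - intros [C th] [[HC Hg] Hs]; exists C; split; [auto|]; exists th; split; [|auto].
    intros x; destruct (classic (clause_var C x)) as [Hx|Hx].
    + right; split; [exact Hx|].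
      destruct (proj1 (Hg x) Hx) as (t & E & Hgr & Hwf); exists t; split; [|auto].
      apply Hts; repeat split; auto; exact (Hs x t E).
    + left; exact (proj2 (Hg x) Hx).
  - apply covered_union; intros C _.
    exact (covered_image _ (fun th => (C, th)) (covered_substs _ ts)).
Qed.

(** * Total models of worlds and their stability *)

Section SoundBounded.

Context {L : language} (T : lpad L) (HT : valid_lpad T)
  (Ffin : exists fs : list (Fsym L), forall f, In f fs)
  (Hsound : sound T) (Hbnd : lpad_bounded_term_size T).

Definition M (g : inst L -> nat) : interp L := WM (W T g).

Lemma W_bounded g : ok T g -> bounded_term_size (W T g).
Proof. intros Hg; rewrite <- world_sel by auto; apply Hbnd, sel_selection, Hg. Qed.

Lemma M_two_valued g : ok T g -> two_valued (M g).
Proof.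
  intros Hg; apply (Hsound (sel T g)); [now apply sel_selection|].
  rewrite world_sel by auto; apply WM_is_wfm.
Qed.

Lemma M_lit_total g c l :
  ok T g -> valid T c -> In l (bd c) -> lit_true (M g) l \/ lit_false (M g) l.
Proof.
  intros Hg Hc Hl; pose proof (M_two_valued g Hg _ (bd_herbrand T c l HT Hc Hl)).
  destruct l; simpl in *; tauto.
Qed.

Lemma M_rule g c : valid T c -> btrue (M g) c -> itrue (M g) (hd c (g c)).
Proof. intros Hc Hb; apply (WM_rule (W T g) (rule c (g c))); [exists c; auto|exact Hb]. Qed.

Lemma M_total g A : ok T g -> hb_opt A -> itrue (M g) A \/ ifalse (M g) A.
Proof.
  intros Hg HA; destruct A as [a|]; [now apply M_two_valued|].
  (* Soundness concerns Herbrand atoms only, so null is treated directly: if it were undetermined,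
     every clause with head null would have a false body literal, and null alone would form an
     unfounded set. *)
  apply NNPP; intros Hn; apply (proj2 (proj2 (WM_is_wfm (W T g))) None).
  apply (Ffix_greatest _ _ (fun A => A = None)); [|auto].
  intros A ->; split; [auto|split; [unfold M in *; tauto|]].
  intros r (c & Hc & ->) E; apply NNPP; intros Hno; apply Hn; left.
  rewrite <- E; apply M_rule; [auto|]; intros l Hl.
  destruct (M_lit_total g c l Hg Hc Hl) as [H|H]; [auto|].
  exfalso; apply Hno; exists l; auto.
Qed.

Lemma M_true_finite g : ok T g -> covered (itrue (M g)).
Proof.
  intros Hg; destruct (bounded_true _ (W_bounded g Hg)) as [n Hn].
  eapply covered_sub;
    [|exact (covered_image _ (fun c => hd c (g c)) (covered_valid_sized T Ffin n))].
  intros A HA; destruct (Hn A HA) as (r & (c & Hc & ->) & <- & Hs); exists c; auto.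
Qed.

(* [M g] is a stable model of the world of [g'], so the total well-founded
   model of that world has to agree with it. *)
Lemma stability g :
  ok T g -> exists n, forall g', ok T g' ->
    (forall c, valid T c -> btrue (M g) c -> itrue (M g) (hd c (g' c))) ->
    (forall c, valid T c -> btrue (M g) c -> sized (snd c) n -> g' c = g c) ->
    ile (M g') (M g).
Proof.
  intros Hg; destruct (bounded_Tfix _ (W_bounded g Hg)) as [n Hn]; exists n.
  intros g' Hg' H1 H2; apply (stage_le (W T g')); [| |apply WM_stage].
  - intros r (c & Hc & ->) Hb; apply H1; auto.
  - intros I HI Hle.
    (* What is derived in the world of [g] is never unfounded in that of [g']: the deriving instance
       is small with a body true in [M g], so both worlds contain the same rule, and none of its
       body literals can be false or unfounded. *)
    assert (Hfound : forall K, wfm_stage (W T g) K -> forall A, itrue K A -> ~ Ffix (W T g') I A).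
    { intros K HK; induction HK as [K HK IH|S HS IH]; simpl.
      2:{ intros A (K & SK & HA); eauto. }
      intros A [HA|HA]; [auto|]; revert A HA; apply Tfix_strong_ind.
      intros r (c & Hc & ->) Hh Hb HF.
      assert (Hb' : btrue (M g) c).
      { intros l Hl; destruct (Hb l Hl) as [Ht|Ht].
        - eapply lit_true_mono; [apply stage_WM; exact HK|exact Ht].
        - eapply lit_true_mono; [apply stage_WM, ws_succ; exact HK|].
          destruct l; simpl in *; tauto. }
      assert (E : g' c = g c).
      { apply H2; auto; apply (Hn K (rule c (g c))); auto; [exists c; auto|].
        eapply body_true_mono; [|exact Hb]; simpl; tauto. }
      rewrite <- E in HF; destruct (Ffix_unfold _ _ _ HF) as (_ & _ & Hall).
      destruct (Hall (rule c (g' c))) as (l & Hl & [Hf|Hf]); [exists c; auto|auto| |].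
      - apply (WM_consistent (W T g) l); [now apply Hb'|].
        eapply lit_false_mono; [exact Hle|exact Hf].
      - destruct (Hb l Hl) as [Ht|Ht]; destruct l; simpl in *; try tauto.
        eapply IH; eauto. }
    intros A HA; destruct (Ffix_unfold _ _ _ HA) as (Hh & _).
    destruct (M_total g A Hg Hh) as [Ht|Hf]; [|auto].
    exfalso; exact (Hfound _ (WM_stage _) A Ht HA).
Qed.

(** * Switching choices and coherent families *)

Definition upd (g : inst L -> nat) (j : nat) (D : inst L -> Prop) (c : inst L) : nat :=
  if excluded_middle_informative (D c) then j else g c.

Lemma upd_in g j (D : inst L -> Prop) c : D c -> upd g j D c = j.
Proof. intros H; unfold upd; destruct (excluded_middle_informative _); tauto. Qed.

Lemma upd_out g j (D : inst L -> Prop) c : ~ D c -> upd g j D c = g c.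
Proof. intros H; unfold upd; destruct (excluded_middle_informative _); tauto. Qed.

Lemma upd_ok g j (D : inst L -> Prop) :
  ok T g -> (forall c, D c -> j < length (head_ext (fst c))) -> ok T (upd g j D).
Proof.
  intros Hg HD c Hc; destruct (classic (D c)) as [H|H];
    [rewrite upd_in|rewrite upd_out]; auto.
Qed.

(** Otherwise every instance with a true body in the switched model keeps its choice. [stability],
    applied from the switched world back to [g], then puts [M g] below that model, where the body of
    [c0] would be true. *)
Lemma switch_keeps_some_body_true g j (D : inst L -> Prop) c0 :
  ok T g -> (forall c, D c -> j < length (head_ext (fst c))) ->
  D c0 -> btrue (M g) c0 -> exists c, D c /\ btrue (M (upd g j D)) c.
Proof.
  intros Hg HD H0 Hb0; apply NNPP; intros Hno.
  pose proof (upd_ok g j D Hg HD) as Hu.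
  assert (Hout : forall c, btrue (M (upd g j D)) c -> upd g j D c = g c).
  { intros c Hb; apply upd_out; intros HDc; apply Hno; eauto. }
  destruct (stability _ Hu) as [n Hn]; apply Hno; exists c0; split; [auto|].
  eapply btrue_mono; [apply (Hn g Hg)|exact Hb0].
  - intros c Hc Hb; rewrite <- (Hout c Hb); now apply M_rule.
  - intros c Hc Hb _; symmetry; auto.
Qed.

(** A zero-or-cofinite law: a true body among switched members forces true bodies among the
    infinitely many unswitched ones. *)
Definition coherent (D : inst L -> Prop) : Prop :=
  forall g, ok T g -> forall c, D c -> btrue (M g) c ->
    covered (fun c' => D c' /\ ~ btrue (M g) c').

(** Shrink [D] until each body literal is constant or finite-to-one in the instance. Constant
    literals have the same truth value on all members. A finite-to-one positive literal would make
    infinitely many atoms true in [M g]; a finite-to-one negative one fails only finitely often, as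
    each model has finitely many true atoms. *)
Lemma infinite_coherent g C (D : inst L -> Prop) :
  ok T g -> ~ covered D ->
  (forall c, D c -> valid T c /\ btrue (M g) c /\ fst c = C) ->
  exists D', (forall c, D' c -> D c) /\ ~ covered D' /\ coherent D'.
Proof.
  intros Hg HD HDg.
  destruct (constant_or_finite_to_one (lbody C) (fun (c : inst L) l => lsubst (snd c) l) D HD)
    as (D' & Hsub & Hinf & Hdich).
  exists D'; split; [auto|split; [auto|]]; intros k Hk c0 H0 Hb0.
  assert (Hin : forall c l, D' c -> In l (lbody C) -> In (lsubst (snd c) l) (bd c)).
  { intros c l Hc Hl; unfold bd; rewrite (proj2 (proj2 (HDg c (Hsub c Hc)))).
    now apply in_map. }
  apply covered_sub with (fun c => exists l, In l (lbody C) /\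
                           (D' c /\ ~ lit_true (M k) (lsubst (snd c) l))).
  { intros c [Hc Hn]; apply NNPP; intros Hno; apply Hn; intros l Hl.
    apply in_map_iff in Hl; destruct Hl as (l' & <- & Hl').
    rewrite (proj2 (proj2 (HDg c (Hsub c Hc)))) in Hl'.
    apply NNPP; intros Hf; apply Hno; eauto. }
  apply covered_union; intros l Hl; destruct (Hdich l Hl) as [[z Hz]|Hfin].
  { exists []; intros c [Hc Hn]; apply Hn; rewrite (Hz c Hc), <- (Hz c0 H0); auto. }
  assert (Hfib : forall k' (f : atom L -> literal L), ok T k' ->
            covered (fun c => exists a, itrue (M k') (Some a) /\ D' c /\ lsubst (snd c) l = f a)).
  { intros k' f Hk'; destruct (M_true_finite k' Hk') as [As HAs].
    apply covered_sub with (fun c => exists A, In A As /\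
            exists a, A = Some a /\ D' c /\ lsubst (snd c) l = f a).
    - intros c (a & Ha & Hc); exists (Some a); split; [now apply HAs|eauto].
    - apply covered_union; intros [a|] _.
      + eapply covered_sub; [|exact (Hfin (f a))]; intros c (a' & [= <-] & Hc); auto.
      + exists []; intros c (a & [=] & _). }
  destruct l as [a|a].
  - exfalso; apply Hinf; eapply covered_sub; [|exact (Hfib g Pos Hg)].
    intros c Hc; exists (asubst (snd c) a).
    split; [exact (proj1 (proj2 (HDg c (Hsub c Hc))) _ (Hin c _ Hc Hl))|auto].
  - eapply covered_sub; [|exact (Hfib k Neg Hk)].
    intros c [Hc Hn]; exists (asubst (snd c) a).
    destruct (M_lit_total k c _ Hk (proj1 (HDg c (Hsub c Hc))) (Hin c _ Hc Hl)); [tauto|auto].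
Qed.

(** * Infinite families of sensitive instances *)

Section SwitchableFamily.

Context (g : inst L -> nat) (j : nat) (h h' : option (atom L)) (D : inst L -> Prop)
  (Hg : ok T g) (Dinf : ~ covered D) (Dcoh : coherent D)
  (Dvalid : forall c, D c -> valid T c) (Dtrue : forall c, D c -> btrue (M g) c)
  (Dj : forall c, D c -> j < length (head_ext (fst c)))
  (Dh : forall c, D c -> hd c (g c) = h) (Dh' : forall c, D c -> hd c j = h')
  (Hh' : ~ itrue (M g) h').

(* The world of [g] in which [h] and [h'] can never become false. *)
Definition protected : gprog L :=
  fun r => W T g r \/ (gbody r = [] /\ (ghead r = h \/ ghead r = h')).

(** Only the false part uses [protected]; the true part must not gain the added facts [h] and [h'].
    The start is the empty union, so that it is literally a stage. *)
Fixpoint J (n : nat) : interp L :=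
  match n with
  | 0 => isup (fun _ => False)
  | S n => mkInterp (fun A => itrue (J n) A \/ Tfix (W T g) (J n) A)
                    (fun A => ifalse (J n) A \/ Ffix protected (J n) A)
  end.

Lemma J_mono m n : m <= n -> ile (J m) (J n).
Proof.
  induction 1 as [|n Hmn IH]; [split; auto|].
  destruct IH; split; simpl; auto.
Qed.

Lemma J_le_M n : ile (J n) (M g).
Proof.
  induction n as [|n IH]; [split; intros A (I & [] & _)|].
  split; simpl; intros A [HA|HA]; try (now apply IH).
  - exact (Tfix_sub _ _ _ (WM_rule (W T g)) IH A HA).
  - refine (Ffix_transfer protected (W T g) _ _ _ IH _ A HA); [now left|apply WM_is_wfm].
Qed.

(** The true parts grow inside the finite true part of [M g], so they stop at some [N]. From then on
    negative literals falsify nothing new, and the unfounded set found at [N] absorbs the one at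
    [S N]; hence the index [S N]. *)
Lemma J_fixpoint :
  exists m, (forall A, ~ Tfix (W T g) (J m) A) /\ (forall A, ~ Ffix protected (J m) A).
Proof.
  destruct (M_true_finite g Hg) as [l Hl].
  destruct (monotone_stabilises (fun n => itrue (J n)) l) as [N HN].
  { intros m n A Hmn; apply (J_mono m n Hmn). }
  assert (Hst : forall n A, itrue (J n) A -> itrue (J N) A).
  { intros n A HA; apply (HN n); [apply Hl, (J_le_M n)|]; exact HA. }
  exists (S N); split; intros A HA.
  - apply (Tfix_disjoint _ _ _ HA); left; apply (Hst (S (S N))); right; exact HA.
  - destruct (Ffix_unfold _ _ _ HA) as (_ & Hn & _); apply Hn; right.
    apply (Ffix_greatest protected (J N)
             (fun B => Ffix protected (J N) B \/ Ffix protected (J (S N)) B)); [|auto].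
    intros B [HB|HB]; destruct (Ffix_unfold _ _ _ HB) as (Hb & HnB & Hall);
      (split; [exact Hb|split]).
    + exact HnB.
    + intros r Hr Er; destruct (Hall r Hr Er) as (k & Hk & Hf); exists k; split; [auto|].
      destruct Hf as [Hf|Hf]; [now left|right]; destruct k; simpl in *; auto.
    + intros HC; apply HnB; now left.
    + intros r Hr Er; destruct (Hall r Hr Er) as (k & Hk & Hf); exists k; split; [auto|].
      destruct k as [a|a]; simpl in Hf.
      * simpl; tauto.
      * destruct Hf as [Hf|[]]; left; exact (Hst (S N) _ Hf).
Qed.

Lemma switched_ok (D1 : inst L -> Prop) : (forall c, D1 c -> D c) -> ok T (upd g j D1).
Proof. intros Hs; apply upd_ok; auto. Qed.

(** Some switched instance keeps a true body, which gives [h']; coherence then supplies an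
    unswitched one, which gives [h]. *)
Lemma switched_heads_true (D1 : inst L -> Prop) :
  (forall c, D1 c -> D c) -> (exists c, D1 c) -> ~ covered (fun c => D c /\ ~ D1 c) ->
  itrue (M (upd g j D1)) h /\ itrue (M (upd g j D1)) h'.
Proof.
  intros Hs [c0 H0] Hrest; pose proof (switched_ok D1 Hs) as Hok.
  destruct (switch_keeps_some_body_true g j D1 c0) as (c & Hc & Hb); auto.
  split.
  - assert (Hex : exists c', (D c' /\ ~ D1 c') /\ ~ (D c' /\ ~ btrue (M (upd g j D1)) c')).
    { apply infinite_inhabited, infinite_minus; [exact Hrest|].
      exact (Dcoh _ Hok c (Hs c Hc) Hb). }
    destruct Hex as (c' & [Hc' Hn] & Hb').
    replace h with (hd c' (upd g j D1 c')) by (rewrite upd_out; auto).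
    apply M_rule; [auto|]; apply NNPP; tauto.
  - replace h' with (hd c (upd g j D1 c)) by (rewrite upd_in; auto).
    apply M_rule; auto.
Qed.

(** Both heads are true in the final model, so no stage can make them false: the switched world
    behaves as if it were protected. *)
Lemma heads_not_unfounded (D1 : inst L -> Prop) I :
  (forall c, D1 c -> D c) -> (exists c, D1 c) -> ~ covered (fun c => D c /\ ~ D1 c) ->
  wfm_stage (W T (upd g j D1)) I -> forall A, A = h \/ A = h' -> ~ Ffix (W T (upd g j D1)) I A.
Proof.
  intros Hs Hne Hrest HI A HA HF.
  destruct (switched_heads_true D1 Hs Hne Hrest) as [Ht Ht'].
  apply (proj1 (stages_compatible _ _ _ (WM_stage _) (ws_succ _ _ HI) A)).
  split; [|right; exact HF].
  destruct HA as [->| ->]; auto.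
Qed.

(** Switch a single [c] whose body is not true in [J m]. Its rule does not fire there, so [J m]
    bounds all stages of the switched world. But [h'] is true in that world, and would thus be true
    in [M g]. *)
Lemma fixpoint_body_true m :
  (forall A, ~ Tfix (W T g) (J m) A) -> (forall A, ~ Ffix protected (J m) A) ->
  forall c, D c -> btrue (J m) c.
Proof.
  intros HT0 HF0 c Hc; apply NNPP; intros Hn.
  assert (Hs : forall c', c = c' -> D c') by (intros; subst; auto).
  assert (Hrest : ~ covered (fun c' => D c' /\ c <> c')).
  { apply infinite_minus; [auto|]; exists [c]; simpl; auto. }
  assert (Hne : exists c', c = c') by eauto.
  apply Hh', (J_le_M m).
  refine (proj1 (stage_le (W T (upd g j (eq c))) (J m) _ _ _ (WM_stage _)) h' _);
    [| |exact (proj2 (switched_heads_true (eq c) Hs Hne Hrest))].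
  - intros r (c' & Hc' & ->) Hb; simpl.
    rewrite upd_out by (intros <-; auto); apply NNPP; intros Hf.
    apply (HT0 (hd c' (g c'))), (Tfix_rule _ _ (rule c' (g c'))); [exists c'; auto|auto|].
    intros l Hl; left; auto.
  - intros I HI Hle; intros A HA.
    refine (Ffix_transfer _ protected _ _ _ Hle HF0 A HA).
    intros r [(c' & Hc' & ->)|[_ Hr]] HF.
    + exists c'; split; [auto|]; rewrite upd_out; [auto|intros <-].
      revert HF; apply heads_not_unfounded; auto; left; apply (Dh c Hc).
    + exfalso; revert HF; apply heads_not_unfounded; auto.
Qed.

Definition active (n : nat) (c : inst L) : Prop :=
  body_true (J n) (Tfix (W T g) (J n)) (rule c j).

(** Before [k] the switched instances fire under neither choice, so the true parts agree. The false
    parts agree because [h] and [h'] are never unfounded: by the added facts on one side, by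
    [heads_not_unfounded] on the other. *)
Lemma J_stage (D1 : inst L -> Prop) k :
  (forall c, D1 c -> D c) -> (exists c, D1 c) -> ~ covered (fun c => D c /\ ~ D1 c) ->
  (forall n c, n < k -> D1 c -> ~ active n c) -> wfm_stage (W T (upd g j D1)) (J k).
Proof.
  intros Hs Hne Hrest; induction k as [|k IH]; intros Hina; [apply ws_sup; tauto|].
  assert (HJ : wfm_stage (W T (upd g j D1)) (J k)) by auto.
  replace (J (S k)) with (wfm_succ (W T (upd g j D1)) (J k)); [now apply ws_succ|].
  assert (H1 : forall A, Tfix (W T (upd g j D1)) (J k) A -> Tfix (W T g) (J k) A).
  { apply Tfix_least; intros r (c & Hc & ->) Hn Hb.
    destruct (classic (D1 c)) as [H|H]; [exfalso; exact (Hina k c ltac:(lia) H Hb)|].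
    rewrite upd_out in * by exact H; apply Tfix_rule; auto; exists c; auto. }
  simpl; unfold wfm_succ; f_equal; apply functional_extensionality; intros A;
    apply propositional_extensionality; apply or_iff_compat_l; split.
  - apply H1.
  - revert A; apply Tfix_strong_ind; intros r (c & Hc & ->) Hn Hb.
    destruct (classic (D1 c)) as [H|H].
    + exfalso; refine (Hina k c ltac:(lia) H (body_true_mono _ _ _ _ _ Hb)); simpl; tauto.
    + rewrite <- (upd_out g j D1 c H) in *; apply Tfix_rule; [exists c; auto|auto|].
      eapply body_true_mono; [|exact Hb]; simpl; tauto.
  - apply Ffix_greatest; intros B HB.
    destruct (Ffix_unfold _ _ _ HB) as (Hb & Hn & Hall); repeat split; auto.
    intros r [(c & Hc & ->)|[_ Hr]] <-.
    + apply Hall; [|auto]; exists c; split; [auto|]; rewrite upd_out; [auto|intros H].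
      revert HB; apply heads_not_unfounded; auto; left; apply (Dh c); auto.
    + exfalso; revert HB; apply heads_not_unfounded; auto.
  - apply Ffix_greatest; intros B HB.
    destruct (Ffix_unfold _ _ _ HB) as (Hb & Hn & Hall); repeat split; auto.
    intros r (c & Hc & ->) <-; destruct (classic (D1 c)) as [H|H].
    + rewrite upd_in in * by exact H.
      destruct (Hall (mkGinst h' [] (snd c))) as (l & [] & _); [right; auto|].
      symmetry; apply Dh'; auto.
    + rewrite upd_out in * by exact H; apply Hall; [left; exists c; auto|auto].
Qed.

(* One instance of [E] may be needed to derive [h]; it is left unswitched. *)
Lemma switch_preserving_Tfix (E : inst L -> Prop) k :
  (forall c, E c -> D c) -> ~ covered E ->
  exists D1, (forall c, D1 c -> E c) /\ ~ covered D1 /\ ~ covered (fun c => D c /\ ~ D1 c) /\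
    forall A, Tfix (W T g) (J k) A -> Tfix (W T (upd g j D1)) (J k) A.
Proof.
  intros HE Einf; destruct (infinite_split E Einf) as (E1 & H1 & Hi1 & Hi2).
  (* [P0] drops all of [E]. If it already makes the body of some [c0] in [E] true, this [c0]
     replaces every switched instance in deriving [h]; if not, no instance of [E] fires and all
     derivations lie in [P0]. *)
  set (P0 := fun r => exists c, valid T c /\ ~ E c /\ r = rule c (g c)).
  assert (HP0 : forall D1 : inst L -> Prop, (forall c, D1 c -> E c) ->
            forall A, Tfix P0 (J k) A -> Tfix (W T (upd g j D1)) (J k) A).
  { intros D1 HD1; apply Tfix_least; intros r (c & Hc & Hn & ->) Hh Hb.
    apply Tfix_rule; auto; exists c; rewrite upd_out; auto. }
  destruct (classic (exists c, E c /\ body_true (J k) (Tfix P0 (J k)) (rule c (g c))))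
    as [(c0 & H0 & Hb0)|Hno].
  - exists (fun c => E1 c /\ c <> c0); split; [intros c [Hc _]; auto|split; [|split]].
    + apply (infinite_minus E1 (fun c => c = c0)); [auto|exists [c0]; intros c ->; now left].
    + intros HC; apply Hi2; eapply covered_sub; [|exact HC].
      intros c [Hc Hn]; split; [auto|tauto].
    + apply Tfix_least; intros r (c & Hc & ->) Hh Hb.
      destruct (classic (E1 c /\ c <> c0)) as [H|H].
      * simpl in *; rewrite (Dh c) in * by (apply HE, H1, H).
        rewrite <- (Dh c0 (HE c0 H0)) in *.
        apply (Tfix_rule _ _ (rule c0 (g c0))); [|auto|].
        -- exists c0; split; [auto|]; rewrite upd_out; [auto|tauto].
        -- eapply body_true_mono; [|exact Hb0].
           apply (HP0 (fun c => E1 c /\ c <> c0)); intros c' [Hc' _]; auto.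
      * apply Tfix_rule; auto; exists c; rewrite upd_out; auto.
  - exists E1; split; [auto|split; [auto|split]].
    + intros HC; apply Hi2; eapply covered_sub; [|exact HC].
      intros c [Hc Hn]; auto.
    + intros A HA; apply HP0; [auto|]; revert A HA.
      apply Tfix_least; intros r (c & Hc & ->) Hh Hb.
      apply Tfix_rule; auto; exists c; split; [auto|split; [|auto]].
      intros H; apply Hno; eauto.
Qed.

Lemma no_switchable_family : False.
Proof.
  destruct J_fixpoint as (m & HT0 & HF0).
  pose proof (fixpoint_body_true m HT0 HF0) as Hbm.
  destruct (least_nat (fun n => ~ covered (fun c => D c /\ active n c)) m) as (k & Hk & Hlt).
  { intros HC; apply Dinf; eapply covered_sub; [|exact HC].
    intros c Hc; split; [auto|]; intros l Hl; left; exact (Hbm c Hc l Hl). }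
  (* The members first active at [k]: still infinitely many, since by minimality of [k] each earlier
     stage activates only finitely many. *)
  set (E := fun c => (D c /\ active k c) /\
                     ~ exists n, In n (seq 0 k) /\ (D c /\ active n c)).
  assert (Einf : ~ covered E).
  { apply infinite_minus; [exact Hk|]; apply covered_union; intros n Hn.
    apply NNPP, Hlt; apply in_seq in Hn; lia. }
  destruct (switch_preserving_Tfix E k) as (D1 & HE & Hi & Hrest & HTf);
    [unfold E; tauto|auto|].
  assert (Hs : forall c, D1 c -> D c) by (intros c Hc; now apply HE in Hc as [[]]).
  pose proof (switched_ok D1 Hs) as Hok.
  assert (HJ : wfm_stage (W T (upd g j D1)) (J k)).
  { apply J_stage; auto; [now apply infinite_inhabited|].
    intros n c Hn Hc Ha; destruct (HE c Hc) as [_ Hno]; apply Hno; exists n.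
    rewrite in_seq; repeat split; auto; lia. }
  destruct (bounded_Tfix _ (W_bounded _ Hok)) as [b Hb].
  apply Hi; eapply covered_sub; [|exact (covered_valid_sized T Ffin b)].
  intros c Hc; split; [auto|].
  apply (Hb (J k) (rule c j)); auto.
  - exists c; rewrite upd_in; auto.
  - simpl; rewrite (Dh' c) by auto; intros Ht; apply Hh', (J_le_M k), Ht.
  - eapply body_true_mono; [exact HTf|]; now apply HE in Hc as [[]].
Qed.

End SwitchableFamily.

Lemma finitely_many_sensitive_instances g :
  ok T g ->
  covered (fun c => valid T c /\ btrue (M g) c /\
    exists i, i < length (head_ext (fst c)) /\ ~ itrue (M g) (hd c i)).
Proof.
  intros Hg; apply NNPP; intros H0.
  destruct (pigeonhole _ T (fun C c => fst c = C) H0) as (C & _ & H1).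
  { intros c [[HC _] _]; eauto. }
  destruct (M_true_finite g Hg) as [As HAs].
  destruct (pigeonhole _ As (fun A c => hd c (g c) = A) H1) as (h & _ & H2).
  { intros c [(Hc & Hb & _) _]; exists (hd c (g c)); split; [now apply HAs, M_rule|auto]. }
  destruct (pigeonhole _ (seq 0 (length (head_ext C)))
              (fun i c => i < length (head_ext C) /\ ~ itrue (M g) (hd c i)) H2)
    as (j & _ & H3).
  { intros c [[(_ & _ & i & Hi & Hn) <-] _]; exists i; rewrite in_seq; repeat split; auto; lia. }
  destruct (infinite_coherent g C _ Hg H3) as (D & Hsub & Dinf & Dcoh).
  { intros c H; tauto. }
  assert (HD : forall c, D c -> valid T c /\ btrue (M g) c /\ j < length (head_ext (fst c)) /\
                 hd c (g c) = h /\ ~ itrue (M g) (hd c j)).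
  { intros c Hc; destruct (Hsub c Hc) as [[[(Hv & Hb & _) <-] Hh] [Hj Hn]]; auto. }
  clear - HT Ffin Hsound Hbnd Hg HD Dinf Dcoh.
  (* To get a common alternative head, switch all of [D] to [j]. Some body stays true, hence
     cofinitely many do; their heads are then true in a model with finitely many true atoms, so
     infinitely many coincide. *)
  assert (Hok : ok T (upd g j D)) by (apply upd_ok; [auto|intros c Hc; apply HD, Hc]).
  destruct (infinite_inhabited D Dinf) as [c0 H0].
  destruct (switch_keeps_some_body_true g j D c0) as (c1 & H1 & Hb1); auto;
    [intros c Hc; apply HD, Hc|apply HD, H0|].
  destruct (M_true_finite _ Hok) as [As HAs].
  destruct (pigeonhole _ As (fun A c => hd c j = A)
              (infinite_minus _ _ Dinf (Dcoh _ Hok c1 H1 Hb1))) as (h' & _ & H2).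
  { intros c [Hc Hn]; exists (hd c j); split; [|auto]; apply HAs.
    replace (hd c j) with (hd c (upd g j D c)) by (now rewrite upd_in).
    apply M_rule; [apply HD, Hc|apply NNPP; tauto]. }
  apply (no_switchable_family g j h h' _ Hg H2);
    try (intros c [[Hc _] Hh]; specialize (HD c Hc); tauto).
  - intros k Hk c [[Hc _] _] Hb; eapply covered_sub; [|exact (Dcoh k Hk c Hc Hb)].
    simpl; tauto.
  - destruct (infinite_inhabited _ H2) as (c & [Hc _] & <-); apply HD, Hc.
Qed.

(** * Finite determination of models *)

(** Fixing the sensitive instances keeps [M g] closed under the rules of [g']; fixing the small ones
    keeps its derivations. [stability] gives one inclusion, totality of [M g'] the other. *)
Lemma finitely_determined g :
  ok T g -> exists S : list (inst L), forall g', ok T g' ->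
    (forall c, In c S -> valid T c -> g' c = g c) ->
    forall A, hb_opt A -> (itrue (M g') A <-> itrue (M g) A).
Proof.
  intros Hg; destruct (stability g Hg) as [n Hn].
  destruct (finitely_many_sensitive_instances g Hg) as [S1 H1].
  destruct (covered_valid_sized T Ffin n) as [S2 H2].
  exists (S1 ++ S2); intros g' Hg' HS A HA.
  assert (Hle : ile (M g') (M g)).
  { apply (Hn g' Hg').
    - intros c Hc Hb; apply NNPP; intros Hf; apply Hf.
      rewrite HS; [now apply M_rule| |auto].
      apply in_or_app; left; apply H1; split; [auto|split; [auto|]].
      exists (g' c); auto.
    - intros c Hc _ Hs; apply HS; [apply in_or_app; right; apply H2|]; auto. }
  split; [apply Hle|]; intros Ht.
  destruct (M_total g' A Hg' HA) as [H|H]; [auto|exfalso].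
  apply (proj1 (stages_compatible _ _ _ (WM_stage (W T g)) (WM_stage (W T g)) A)).
  split; [exact Ht|apply Hle, H].
Qed.

(** * Compactness *)

Section Compactness.

Context (A : atom L) (HA : herbrand_base A).

Definition extends (g : inst L -> nat) (p : list (inst L * nat)) : Prop :=
  forall c i, In (c, i) p -> g c = i.

(** The theorem relativised to the selections extending the partial selection [p]; the goal is the
    case of empty [p]. *)
Definition explained (p : list (inst L * nat)) : Prop :=
  exists K : list (cchoice L),
    (forall k, In k K -> explanation T A k /\ finite_choice k) /\
    forall g, ok T g -> extends g p -> itrue (M g) (Some A) ->
      exists k, In k K /\ subchoice k (sel T g).

Lemma explained_split p c :
  valid T c -> (forall i, i < length (head_ext (fst c)) -> explained ((c, i) :: p)) ->
  explained p.
Proof.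
  intros Hc Hall.
  assert (H : forall n, n <= length (head_ext (fst c)) -> exists K : list (cchoice L),
    (forall k, In k K -> explanation T A k /\ finite_choice k) /\
    forall g, ok T g -> extends g p -> g c < n -> itrue (M g) (Some A) ->
      exists k, In k K /\ subchoice k (sel T g)).
  { induction n as [|n IH]; intros Hn.
    - exists []; split; [intros k []|intros; lia].
    - destruct IH as (K & HK & Hcov); [lia|].
      destruct (Hall n) as (K' & HK' & Hcov'); [lia|].
      exists (K ++ K'); split.
      + intros k Hk; apply in_app_or in Hk; destruct Hk; auto.
      + intros g Hg Hp Hlt Ht; destruct (Nat.eq_dec (g c) n) as [E|Hne].
        * destruct (Hcov' g Hg) as (k & Hk & Hs); [|auto|].
          -- intros c' i [[= <- <-]|Hi]; auto.
          -- exists k; split; [apply in_or_app|]; auto.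
        * destruct (Hcov g Hg Hp) as (k & Hk & Hs); [lia|auto|].
          exists k; split; [apply in_or_app|]; auto. }
  destruct (H (length (head_ext (fst c)))) as (K & HK & Hcov); [lia|].
  exists K; split; auto.
Qed.

Lemma unexplained_extension p cs :
  ~ explained p ->
  exists q, ~ explained q /\ incl p q /\
    forall c, In c cs -> valid T c -> exists i, In (c, i) q.
Proof.
  intros Hp; induction cs as [|c cs (q & Hq & Hpq & Hd)].
  - exists p; split; [auto|split; [apply incl_refl|intros c []]].
  - destruct (classic (valid T c)) as [Hc|Hc].
    + assert (Hi : exists i, ~ explained ((c, i) :: q)).
      { apply NNPP; intros Hno; apply Hq, (explained_split q c Hc); intros i _.
        apply NNPP; eauto. }
      destruct Hi as [i Hi]; exists ((c, i) :: q); split; [auto|split].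
      * now apply incl_tl.
      * intros c' [<-|Hc'] Hv; [exists i; now left|].
        destruct (Hd c' Hc' Hv) as [i' Hi']; exists i'; now right.
    + exists q; split; [auto|split; [auto|]]; intros c' [<-|Hc'] Hv; [tauto|auto].
Qed.

(** If nothing extended [p], the empty set of explanations would suffice. This keeps the limit
    selection within range. *)
Lemma unexplained_extendable p : ~ explained p -> exists g, ok T g /\ extends g p.
Proof.
  intros Hp; apply NNPP; intros Hno; apply Hp; exists []; split; [intros k []|].
  intros g Hg He; exfalso; eauto.
Qed.

Lemma determined_explained g p :
  ok T g ->
  (exists S : list (inst L), (forall c, In c S -> valid T c -> In (c, g c) p) /\
    forall g', ok T g' -> (forall c, In c S -> valid T c -> g' c = g c) ->
    forall B, hb_opt B -> (itrue (M g') B <-> itrue (M g) B)) ->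
  explained p.
Proof.
  intros Hg (S & HS & Hdet).
  assert (Hp : forall g', extends g' p -> forall c, In c S -> valid T c -> g' c = g c) by auto.
  destruct (classic (itrue (M g) (Some A))) as [Ht|Hf].
  (* The restriction of [g] to the valid members of [S] is itself the explanation. *)
  - set (k := fun a : achoice L => In (fst a) S /\ valid T (fst a) /\ snd a = g (fst a)).
    exists [k]; split.
    + intros k' [<-|[]]; split; [split; [split|]|].
      * intros [[C th] i] (_ & Hv & E); simpl in *; subst.
        exact (conj (proj1 Hv) (conj (proj2 Hv) (Hg _ Hv))).
      * intros C th i i' (_ & _ & E) (_ & _ & E'); simpl in *; congruence.
      * intros s Hs Hk; destruct (selection_sel T s Hs) as (g' & Hg' & ->).
        rewrite world_sel by auto; apply wfm_true_WM, (Hdet g' Hg'); [|exact HA|exact Ht].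
        intros c Hc Hv; destruct (Hk (c, g c)) as [_ E]; [repeat split; auto; apply Hv|].
        simpl in E; congruence.
      * exists (map (fun c => (c, g c))
                 (filter (fun c => if excluded_middle_informative (valid T c)
                                   then true else false) S)).
        intros [c i]; rewrite in_map_iff; unfold k; simpl; split.
        -- intros (Hc & Hv & ->); exists c; split; [auto|]; apply filter_In.
           destruct (excluded_middle_informative _); tauto.
        -- intros (c' & [= -> <-] & Hc'); apply filter_In in Hc'.
           destruct (excluded_middle_informative (valid T c)); intuition congruence.
    + intros g' Hg' He _; exists k; split; [now left|].
      intros [c i] (Hc & Hv & E); simpl in *; subst; split; simpl; [auto|].
      symmetry; auto.
  - exists []; split; [intros k []|]; intros g' Hg' He Ht.
    exfalso; apply Hf, (Hdet g' Hg'); auto.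
Qed.

Lemma everything_explained : explained [].
Proof.
  apply NNPP; intros H0.
  assert (Hlev : forall np : nat * list (inst L * nat), exists q, ~ explained (snd np) ->
    ~ explained q /\ incl (snd np) q /\
    forall c, valid T c -> sized (snd c) (fst np) -> exists i, In (c, i) q).
  { intros [n p]; destruct (classic (explained p)) as [Hp|Hp]; [exists p; tauto|].
    destruct (covered_valid_sized T Ffin n) as [cs Hcs].
    destruct (unexplained_extension p cs Hp) as (q & Hq & Hi & Hd).
    exists q; intros _; split; [auto|split; [auto|]]; intros c Hc Hs; apply Hd; auto. }
  apply choice in Hlev; destruct Hlev as [F HF].
  (* Step [n] decides all valid instances of size at most [n], staying unexplained. The limit [g] is
     determined by a finite set [S], which some [p N] decides entirely, so [p N] is explained after
     all. *)
  set (p := fix p n := match n with 0 => [] | S n => F (n, p n) end).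
  assert (Hp : forall n, ~ explained (p n)).
  { induction n as [|n IH]; [exact H0|]; exact (proj1 (HF (n, p n) IH)). }
  assert (Hincl : forall m n, m <= n -> incl (p m) (p n)).
  { induction 1 as [|n Hmn IH]; [apply incl_refl|].
    eapply incl_tran; [exact IH|]; exact (proj1 (proj2 (HF (n, p n) (Hp n)))). }
  assert (Hdec : forall c, exists i, valid T c -> exists n, In (c, i) (p n)).
  { intros c; destruct (classic (valid T c)) as [Hc|Hc]; [|exists 0; tauto].
    destruct (grounding_sized _ _ (proj2 Hc)) as [n Hs].
    destruct (proj2 (proj2 (HF (n, p n) (Hp n))) c Hc Hs) as [i Hi].
    exists i; intros _; exists (S n); exact Hi. }
  apply choice in Hdec; destruct Hdec as [g Hg].
  assert (Hok : ok T g).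
  { intros c Hc; destruct (Hg c Hc) as [n Hn].
    destruct (unexplained_extendable (p n) (Hp n)) as (g' & Hg' & He).
    rewrite <- (He _ _ Hn); auto. }
  destruct (finitely_determined g Hok) as [S HS].
  assert (HN : exists N, forall c, In c S -> valid T c -> In (c, g c) (p N)).
  { clear HS; induction S as [|c S [N IH]]; [exists 0; intros c []|].
    destruct (classic (valid T c)) as [Hc|Hc].
    - destruct (Hg c Hc) as [n Hn]; exists (max n N).
      intros c' [<-|Hc'] Hv; [apply (Hincl n)|apply (Hincl N)]; auto; lia.
    - exists N; intros c' [<-|Hc'] Hv; [tauto|auto]. }
  destruct HN as [N HN]; apply (Hp N), (determined_explained g); eauto.
Qed.

End Compactness.

End SoundBounded.

Theorem theorem2 (L : language)
  (Ffin : exists fs : list (Fsym L), forall f, In f fs)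
  (T : lpad L) (HT : valid_lpad T)
  (Hsound : sound T) (Hbnd : lpad_bounded_term_size T)
  (A : atom L) (HA : herbrand_base A) :
  exists K : list (cchoice L),
    (forall k, In k K -> explanation T A k /\ finite_choice k) /\
    covering_wrt T A (fun k => In k K).
Proof.
  destruct (everything_explained T HT Ffin Hsound Hbnd A HA) as (K & HK & Hcov).
  exists K; split; [exact HK|]; intros s Hs Ht.
  destruct (selection_sel T s Hs) as (g & Hg & ->); apply Hcov; [auto|intros c i []|].
  apply wfm_true_WM; rewrite <- world_sel by auto; exact Ht.
Qed.
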